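(* Let $H_1$ and $H_2$ be Hermitian spaces over the sfields $F_1$ and $F_2$, respectively. Let $f \colon \mathbf P(H_1) \to \mathbf P(H_2)$ be an adjointable map between orthosets of rank $\geq 3$. Then $f$ is induced by a quasilinear map from $H_1$ to $H_2$; that is, there is a quasilinear map $\phi \colon H_1 \to H_2$ such that $f(\langle u\rangle) = \langle \phi(u)\rangle$ for all $u \in H_1$.
   Context: A sfield is a skew field (division ring). A $\ast$-sfield is a sfield $F$ with an involutory antiautomorphism $\ast \colon F \to F$. A Hermitian space over a $\ast$-sfield $F$ is a (left) linear space $H$ over $F$ with a map $(\cdot,\cdot)\colon H\times H\to F$ such that $(\alpha u+\beta v,w)=\alpha(u,w)+\beta(v,w)$, $(w,\alpha u+\beta v)=(w,u)\alpha^\ast+(w,v)\beta^\ast$, $(u,v)=(v,u)^\ast$ for all $u,v,w\in H$, $\alpha,\beta\in F$, and which is anisotropic: $(u,u)=0$ implies $u=0$. We write $u\perp v$ if $(u,v)=0$. Standing assumption: a Hermitian space contains at most countably many mutually orthogonal nonzero vectors. A map $\phi\colon V_1\to V_2$ between linear spaces over sfields $F_1,F_2$ is semilinear if it is additive and there is a (unital) homomorphism $\sigma\colon F_1\to F_2$ with $\phi(\alpha u)=\alpha^\sigma\phi(u)$ for all $u \in V_1$, $\alpha\in F_1$, where $\alpha^\sigma$ is the image of $\alpha$ under $\sigma$; it is quasilinear if $\sigma$ is an isomorphism. An orthoset is a set $X$ with a symmetric binary relation $\perp$ and a constant $0$ such that $x\perp x$ if and only if $x=0$, and $0\perp x$ for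 all $x \in X$. Elements distinct from $0$ are proper. For $A\subseteq X$, $A^\perp=\{x\in X: x\perp y\text{ for all }y\in A\}$; a subspace of $X$ is a subset $A$ with $A=A^{\perp\perp}$, viewed as an orthoset with the inherited relation. The rank of an orthoset is the maximal size $n$ of a set of mutually orthogonal proper elements if such a finite maximum exists, and $\infty$ otherwise. A map $f\colon X\to Y$ between orthosets is adjointable if there is a map $g\colon Y\to X$ (an adjoint of $f$) such that for all $x\in X$, $y\in Y$: $f(x)\perp y$ if and only if $x\perp g(y)$. The rank of an adjointable map $f$ is the rank of the subspace $(\operatorname{im} f)^{\perp\perp}$ of $Y$. For a Hermitian space $H$, $\mathbf P(H)=\{\langle u\rangle: u\in H\}$ is the set of at most one-dimensional subspaces of $H$ ($\langle u\rangle$ denotes the linear span of $u$), viewed as an orthoset with $\langle u\rangle\perp\langle v\rangle$ if $u\perp v$ and with the zero subspace $\{0\}$ as the constant $0$. *)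

(* Defs.v *)
From HB Require Import structures.
From mathcomp Require Import all_boot all_order all_algebra.
From mathcomp Require Import boolp classical_sets functions cardinality.
From mathcomp Require Import constructive_ereal.

Set Implicit Arguments.
Unset Strict Implicit.
Unset Printing Implicit Defensive.

Import Order.TTheory GRing.Theory Num.Theory.

Local Open Scope classical_set_scope.
Local Open Scope card_scope.
Local Open Scope ring_scope.

(* [GRing.field_axiom] makes every nonzero element a unit; multiplication is
   not assumed to be commutative. The star need not differ from the identity. *)
HB.mixin Record isStarSfield F of GRing.UnitRing F := {
  sfieldP : GRing.field_axiom F;
  star : F -> F;
  starD : forall a b, star (a + b) = star a + star b;
  starM : forall a b, star (a * b) = star b * star a;
  starK : involutive star
}.

#[short(type="starSfieldType")]
HB.structure Definition StarSfield := {F of GRing.UnitRing F & isStarSfield F}.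

(* Linear in the first argument, star-linear in the second one. The last field
   is the standing restriction to spaces in which every set of mutually
   orthogonal nonzero vectors is countable. *)
HB.mixin Record isHermitian (F : starSfieldType) H of GRing.Lmodule F H := {
  herm : H -> H -> F;
  hermDZl : forall (a b : F) (u v w : H),
    herm (a *: u + b *: v) w = a * herm u w + b * herm v w;
  hermDZr : forall (a b : F) (u v w : H),
    herm w (a *: u + b *: v) = herm w u * star a + herm w v * star b;
  herm_star : forall u v, herm u v = star (herm v u);
  herm_anisotropic : forall u, herm u u = 0 -> u = 0;
  herm_countable : forall A : set H,
    (forall u, A u -> u <> 0) ->
    (forall u v, A u -> A v -> u <> v -> herm u v = 0) ->
    countable A
}.

#[short(type="hermitianType")]
HB.structure Definition Hermitian (F : starSfieldType) :=
  {H of GRing.Lmodule F H & isHermitian F H}.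

Definition quasilinear (F1 F2 : starSfieldType) (H1 : lmodType F1)
    (H2 : lmodType F2) (phi : H1 -> H2) : Prop :=
  exists sigma : {rmorphism F1 -> F2},
    [/\ bijective sigma,
        {morph phi : u v / u + v} &
        forall a u, phi (a *: u) = sigma a *: phi u].

HB.mixin Record isOrthoset X := {
  ortho : X -> X -> Prop;
  ortho0 : X;
  ortho_sym : forall x y, ortho x y -> ortho y x;
  ortho_refl : forall x, ortho x x <-> x = ortho0;
  ortho_0l : forall x, ortho ortho0 x
}.

#[short(type="orthosetType")]
HB.structure Definition Orthoset := {X of isOrthoset X}.

Notation "x '⊥' y" := (ortho x y) (at level 70, no associativity).

Definition orthocompl (X : orthosetType) (A : set X) : set X :=
  [set x | forall y, A y -> x ⊥ y].

Notation "A '^⊥'" := (orthocompl A) (at level 2, format "A '^⊥'").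

Record subspace (X : orthosetType) := Subspace {
  subspace_set :> set X;
  subspaceP : subspace_set = subspace_set^⊥^⊥
}.

Lemma orthocompl0 (X : orthosetType) (A : set X) : A^⊥ ortho0.
Proof. by move=> y _; exact: ortho_0l. Qed.

Lemma orthocompl_anti (X : orthosetType) (A B : set X) :
  A `<=` B -> B^⊥ `<=` A^⊥.
Proof. by move=> sAB x Bx y /sAB /Bx. Qed.

Lemma sub_orthocomplK (X : orthosetType) (A : set X) : A `<=` A^⊥^⊥.
Proof. by move=> x Ax y Ay; apply: ortho_sym; exact: Ay. Qed.

Lemma orthocomplKK (X : orthosetType) (A : set X) : A^⊥^⊥ = A^⊥^⊥^⊥^⊥.
Proof.
apply/seteqP; split; first exact: sub_orthocomplK.
by apply: orthocompl_anti; exact: sub_orthocomplK.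
Qed.

Definition biorthogonal (X : orthosetType) (A : set X) : subspace X :=
  Subspace (orthocomplKK A).

Definition subspace_sort (X : orthosetType) (A : subspace X) : Type :=
  {x : X | subspace_set A x}.

Section SubspaceOrthoset.
Variables (X : orthosetType) (A : subspace X).

Let sub_ortho (x y : subspace_sort A) : Prop := sval x ⊥ sval y.

Let sub0_proof : subspace_set A ortho0.
Proof. by rewrite subspaceP; exact: orthocompl0. Qed.

Let sub0 : subspace_sort A := exist _ ortho0 sub0_proof.

Let sub_ortho_sym x y : sub_ortho x y -> sub_ortho y x.
Proof. exact: ortho_sym. Qed.

Let sub_ortho_refl x : sub_ortho x x <-> x = sub0.
Proof.
rewrite /sub_ortho ortho_refl; split=> [|->//].
by case: x => x Ax /= x0; exact: eq_exist.
Qed.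

Let sub_ortho_0l x : sub_ortho sub0 x.
Proof. exact: ortho_0l. Qed.

HB.instance Definition _ := isOrthoset.Build (subspace_sort A)
  sub_ortho_sym sub_ortho_refl sub_ortho_0l.

End SubspaceOrthoset.

Definition orthogonal_set (X : orthosetType) (A : set X) : Prop :=
  (forall x, A x -> x <> ortho0) /\
  (forall x y, A x -> A y -> x <> y -> x ⊥ y).

Definition max_orthogonal (X : orthosetType) (n : nat) : Prop :=
  (exists A : set X, orthogonal_set A /\ A #= `I_n) /\
  (forall B : set X, orthogonal_set B -> B #<= `I_n).

(* Extended integers serve only to have [+oo] together with the order. *)
Definition rank (X : orthosetType) : \bar int :=
  match pselect (exists n, max_orthogonal X n) with
  | left ex_max => (projT1 (cid ex_max))%:Z%:E
  | right _ => +oo%E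
  end.

Lemma max_orthogonal_uniq (X : orthosetType) (m n : nat) :
  max_orthogonal X m -> max_orthogonal X n -> m = n.
Proof.
move=> [[A [oA Am]] maxm] [[B [oB Bn]] maxn].
have le_card k l (C : set X) : C #= `I_k -> C #<= `I_l -> (k <= l)%N.
  by move=> Ck Cl; rewrite -card_le_II -(card_le_eql Ck).
by apply/eqP; rewrite eqn_leq (le_card _ _ _ Am (maxn _ oA))
  (le_card _ _ _ Bn (maxm _ oB)).
Qed.

Lemma rankE (X : orthosetType) (n : nat) :
  max_orthogonal X n -> rank X = n%:Z%:E.
Proof.
rewrite /rank; case: pselect => [ex_max|no_max] maxn; last by case: no_max; exists n.
by congr (_%:Z%:E); apply: max_orthogonal_uniq maxn; exact: projT2 (cid ex_max).
Qed.

Lemma rank_pinfty (X : orthosetType) :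
  ~ (exists n, max_orthogonal X n) -> rank X = +oo%E.
Proof. by rewrite /rank; case: pselect. Qed.

Definition adjointable (X Y : orthosetType) (f : X -> Y) : Prop :=
  exists g : Y -> X, forall x y, f x ⊥ y <-> x ⊥ g y.

Definition map_rank (X Y : orthosetType) (f : X -> Y) : \bar int :=
  rank (subspace_sort (biorthogonal (range f))).

Definition line (F : starSfieldType) (H : lmodType F) (u : H) : set H :=
  [set v | exists a : F, v = a *: u].

Definition projective (F : starSfieldType) (H : lmodType F) : Type :=
  {L : set H | exists u, L = line u}.

Definition pline (F : starSfieldType) (H : lmodType F) (u : H) :
    projective H :=
  exist _ (line u) (ex_intro _ u erefl).

Lemma line0 (F : starSfieldType) (H : lmodType F) : line (0 : H) = [set 0].
Proof.
apply/seteqP; split=> [v [a ->]|v ->] /=; first by rewrite scaler0.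
by exists 0; rewrite scaler0.
Qed.

Section HermTheory.
Variables (F : starSfieldType) (H : hermitianType F).
Implicit Types (a b : F) (u v w : H).

Lemma hermZl a u w : herm (a *: u) w = a * herm u w.
Proof. by have := hermDZl a 0 u 0 w; rewrite scale0r addr0 mul0r addr0. Qed.

Lemma hermZr a u w : herm w (a *: u) = herm w u * star a.
Proof.
have star0 : star (0 : F) = 0.
  by apply: (addrI (star 0)); rewrite -starD !addr0.
by have := hermDZr a 0 u 0 w; rewrite scale0r addr0 star0 mulr0 addr0.
Qed.

Lemma herm0l w : herm 0 w = 0.
Proof. by rewrite -(scale0r (0 : H)) hermZl mul0r. Qed.

Lemma herm_sym0 u v : herm u v = 0 -> herm v u = 0.
Proof. by move=> uv; rewrite -(starK (herm v u)) -herm_star uv -(herm0l 0) -herm_star. Qed.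

Lemma line_id u : line u u.
Proof. by exists 1; rewrite scale1r. Qed.

End HermTheory.

Section ProjectiveOrthoset.
Variables (F : starSfieldType) (H : hermitianType F).

Definition pline_ortho (L M : projective H) : Prop :=
  exists u v : H, [/\ L = pline u, M = pline v & herm u v = 0].

(* Independence of the chosen spanning vectors. *)
Lemma pline_orthoE (u v : H) :
  pline_ortho (pline u) (pline v) <-> herm u v = 0.
Proof.
split=> [[u' [v' [uu' vv' o]]]|o]; last by exists u, v.
have [a ->] : line u' u by move/(congr1 sval): uu' => /= <-; exact: line_id.
have [b ->] : line v' v by move/(congr1 sval): vv' => /= <-; exact: line_id.
by rewrite hermZl hermZr o mul0r mulr0.
Qed.

Lemma plineP (L : projective H) : exists u, L = pline u.
Proof. by case: L => L [u Lu]; exists u; exact: eq_exist. Qed.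

Let pline_ortho_sym L M : pline_ortho L M -> pline_ortho M L.
Proof. by move=> [u [v [-> -> /herm_sym0]]] vu; exists v, u. Qed.

Let pline_ortho_refl L : pline_ortho L L <-> L = pline 0.
Proof.
have [u ->] := plineP L; rewrite pline_orthoE; split=> [/herm_anisotropic ->//|].
move=> /(congr1 sval) /= u0; have : line u u by exact: line_id.
by rewrite u0 line0 => /= ->; exact: herm0l.
Qed.

Let pline_ortho_0l L : pline_ortho (pline 0) L.
Proof. by have [u ->] := plineP L; apply/pline_orthoE; exact: herm0l. Qed.

HB.instance Definition _ := isOrthoset.Build (projective H)
  pline_ortho_sym pline_ortho_refl pline_ortho_0l.

End ProjectiveOrthoset.

(* Main.v *)
(* The adjoint makes [f] send the points of a projective line into the span of
   two image points, because a two-dimensional span is the set of vectors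
   orthogonal to everything orthogonal to its generators. Pick [v] spanning a
   nonzero image point and [w] spanning the adjoint image of the line of [v].
   Then [f] sends no point of the affine hyperplane [(p, w) = 1] into the
   hyperplane orthogonal to [v], so its values there have unique
   representatives [n p] with [(n p, v) = 1], and [n p - n q] spans [f] of the
   line of [p - q]. Hence, for a base point [a] and the projection [P] onto the
   orthocomplement of [w] along [a], the map [T d = n (a + P d) - n a] sends
   parallel vectors to parallel vectors, and its image is not contained in a
   line since the rank of [f] is at least 3; this forces [T] to be semilinear,
   with companion [sigma] say, and [u |-> sigma (u, w) n a + T u] induces [f].
   The map [sigma] is onto: if [u1, u2] and [v1, v2] satisfy [(phi ui, vj) = 0]
   exactly for [i <> j], then the orthogonality of [s u1 + u2] to the adjoint
   image of [b v1 + v2], for suitable [s], expresses [(phi u2, v2)] as [- sigma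
   s (phi u1, v1) b^*], where [b <> 0] is arbitrary. *)
From HB Require Import structures.
Require Import Defs.
From mathcomp Require Import all_boot all_order all_algebra.
From mathcomp Require Import boolp classical_sets functions cardinality.
From mathcomp Require Import constructive_ereal.

Set Implicit Arguments.
Unset Strict Implicit.
Unset Printing Implicit Defensive.

Import Order.TTheory GRing.Theory Num.Theory.

Local Open Scope classical_set_scope.
Local Open Scope card_scope.
Local Open Scope ring_scope.

(** * Lines, planes and exchange over a sfield *)

Section Lines.
Variables (F : starSfieldType) (V : lmodType F).
Implicit Types (a b c : F) (x y z : V).

Definition span2 x y : set V := [set z | exists a b, z = a *: x + b *: y].

(** The nonzero factor makes this an equivalence relation: spanning the same line, the zero vector
    being related only to itself. *)
Definition proportional x y := exists2 c, c != 0 & x = c *: y.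

Lemma sfield_unit a : a != 0 -> a \is a GRing.unit.
Proof. exact: sfieldP. Qed.

Lemma sfield_scaleK a x : a != 0 -> a^-1 *: (a *: x) = x.
Proof. by move=> /sfield_unit ua; rewrite scalerA mulVr ?scale1r. Qed.

Lemma scale_sfield_eq0 a x : a *: x = 0 -> x <> 0 -> a = 0.
Proof.
move=> ax0 x0; apply/eqP/negP => /negP/sfield_unit ua; apply: x0.
by rewrite -(scale1r x) -(mulVr ua) -scalerA ax0 scaler0.
Qed.

Lemma scale_sfield_inj a b x : x <> 0 -> a *: x = b *: x -> a = b.
Proof.
move=> x0 ab; apply/subr0_eq/(scale_sfield_eq0 _ x0).
by rewrite scalerBl ab subrr.
Qed.

Lemma lineZ a x y : line x y -> line x (a *: y).
Proof. by move=> [b ->]; exists (a * b); rewrite scalerA. Qed.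

Lemma lineD x y z : line x y -> line x z -> line x (y + z).
Proof. by move=> [a ->] [b ->]; exists (a + b); rewrite scalerDl. Qed.

Lemma lineB x y z : line x y -> line x z -> line x (y - z).
Proof. by move=> [a ->] [b ->]; exists (a - b); rewrite scalerBl. Qed.

Lemma line_refl x : line x x.
Proof. by exists 1; rewrite scale1r. Qed.

Lemma line_trans x y z : line x y -> line y z -> line x z.
Proof. by move=> xy [a ->]; exact: lineZ. Qed.

Lemma lineK a x y : a != 0 -> line x (a *: y) -> line x y.
Proof. by move=> a0 /(lineZ a^-1); rewrite sfield_scaleK. Qed.

Lemma proportional_line x y : proportional x y -> line y x.
Proof. by move=> [c _ ->]; exists c. Qed.

Lemma proportional_sym x y : proportional x y -> proportional y x.
Proof.
move=> [c c0 ->]; exists c^-1; last by rewrite sfield_scaleK.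
by apply: contra_neq c0 => ci0; rewrite -(invrK c) ci0 invr0.
Qed.

Lemma proportional_trans x y z :
  proportional x y -> proportional y z -> proportional x z.
Proof.
move=> [c c0 ->] [d d0 ->]; exists (c * d); last by rewrite scalerA.
by apply: contra_neq d0 => cd0; rewrite -(mulKr (sfield_unit c0) d) cd0 mulr0.
Qed.

Lemma mutual_proportional x y : line x y -> line y x -> proportional x y.
Proof.
move=> [a ya] [b xb]; have [b0|b0] := eqVneq b 0; last by exists b.
have x0 : x = 0 by rewrite xb b0 scale0r.
by exists 1; rewrite ?oner_neq0 // ya x0 !scaler0.
Qed.

Lemma proportional_pline x y : proportional x y -> pline x = pline y.
Proof.
move=> xy; apply: eq_exist; apply/seteqP; split=> z.
  by apply: line_trans; exact: proportional_line.
by apply: line_trans; apply: proportional_line; exact: proportional_sym.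
Qed.

(** Only the coefficient of [y] is determined, since [~ line x y] allows [x = 0]. *)
Lemma nonline_coef a b a' b' x y : ~ line x y ->
  a *: x + b *: y = a' *: x + b' *: y -> b = b'.
Proof.
move=> nxy eq_ab; apply/eqP; rewrite -subr_eq0; apply/negP => /negP b0.
apply/nxy/(lineK b0); exists (a' - a); rewrite !scalerBl.
by apply/eqP; rewrite subr_eq addrAC -eq_ab addrAC subrr add0r.
Qed.

Lemma span2C x y : span2 x y = span2 y x.
Proof. by apply/seteqP; split=> z [a [b ->]]; exists b, a; rewrite addrC. Qed.

Lemma span2_trans x y x' y' z :
  span2 x y x' -> span2 x y y' -> span2 x' y' z -> span2 x y z.
Proof.
move=> [a [b ->]] [c [d ->]] [k [l ->]].
exists (k * a + l * c), (k * b + l * d).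
by rewrite !scalerDr !scalerA addrACA -!scalerDl.
Qed.

Lemma span2l x y : span2 x y x.
Proof. by exists 1, 0; rewrite scale1r scale0r addr0. Qed.

Lemma span2r x y : span2 x y y.
Proof. by exists 0, 1; rewrite scale1r scale0r add0r. Qed.

Lemma line_span2 x y z z' : span2 x y z -> line z z' -> span2 x y z'.
Proof.
move=> [a [b ->]] [c ->]; exists (c * a), (c * b).
by rewrite scalerDr !scalerA.
Qed.

Lemma span2_exchange x y z : span2 x y z -> ~ line x z -> span2 x z y.
Proof.
move=> [a [b zab]] nxz; have b0 : b != 0.
  apply/negP => /eqP b0; apply: nxz; exists a.
  by rewrite zab b0 scale0r addr0.
exists (- (b^-1 * a)), b^-1; rewrite zab scalerDr !scalerA scaleNr addKr.
by rewrite mulVr ?sfield_unit // scale1r.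
Qed.

(** Two exchange steps. If [p] is on the line of [x], it replaces [x], and [q] then replaces [y];
    otherwise [p] replaces [y], and [q] then replaces [x]. *)
Lemma span2_nonline_sub x y p q r : p <> 0 -> span2 x y p -> span2 x y q ->
  ~ line p q -> span2 x y r -> span2 p q r.
Proof.
move=> p0 sp sq npq; suff [sx sy] : span2 p q x /\ span2 p q y.
  exact: span2_trans.
have [[a pa]|nxp] := pselect (line x p).
  have a0 : a != 0 by apply/eqP => a0; apply: p0; rewrite pa a0 scale0r.
  have px : line p x by apply: (lineK a0); rewrite -pa; exact: line_refl.
  have sx : span2 p q x by exact: line_span2 (span2l p q) px.
  split=> //; apply: span2_exchange npq.
  apply: span2_trans sq; last exact: span2r.
  exact: line_span2 (span2l p y) px.
have sy : span2 p x y by rewrite span2C; exact: span2_exchange.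
have sx : span2 p q x.
  apply: span2_exchange npq; apply: span2_trans sq => //; exact: span2r.
by split=> //; apply: span2_trans sy => //; exact: span2l.
Qed.
End Lines.

(** * Semilinearity from preservation of parallels *)

Section Semilinear.
Variables (F1 F2 : starSfieldType) (V1 : lmodType F1) (V2 : lmodType F2).
Variable T : V1 -> V2.
Hypothesis TD : forall d e, exists c, T (d + e) = T d + c *: T e.
Hypothesis TZ : forall s d, line (T d) (T (s *: d)).
Hypothesis T_nonline : forall y, exists e, ~ line y (T e).

(** Exchanging [d] and [e] in [TD] gives a second expansion of [T (d + e)], in which [T e] has
    coefficient 1. *)
Lemma parallel_additive_nonline d e :
  ~ line (T d) (T e) -> T (d + e) = T d + T e.
Proof.
move=> nde; have [c Tde] := TD d e; have [c' Ted] := TD e d.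
suff c1 : c = 1 by rewrite Tde c1 scale1r.
apply: (nonline_coef (a := 1) (a' := c') nde).
by rewrite !scale1r -Tde addrC Ted addrC.
Qed.

(** For parallel images, choose [T e'] off their line and expand [T (d + e + e')] in two ways; each
    sum split on the way has nonparallel images. *)
Lemma parallel_additive : {morph T : d e / d + e}.
Proof.
move=> d e; have [lde|] := pselect (line (T d) (T e)); last first.
  exact: parallel_additive_nonline.
have [e' nde'] := T_nonline (T d).
have [c Tee'] := TD e e'; have [c' Tde] := TD d e.
have Tee : T (e + e') = T e + T e'.
  by apply: parallel_additive_nonline => lee'; apply/nde'/(line_trans lde).
apply: (addIr (T e')); rewrite -addrA -Tee -!parallel_additive_nonline ?addrA //.
- move=> lee'; apply: nde'; rewrite -(addKr (T e) (T e')) -Tee addrC.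
  exact: lineB.
- move=> l; apply: nde'; apply: line_trans l; rewrite Tde.
  by apply: lineD; [exact: line_refl|exact: lineZ].
Qed.

Lemma parallel_semilinear : exists sigma : {rmorphism F1 -> F2},
  forall a u, T (a *: u) = sigma a *: T u.
Proof.
have [d nd] := T_nonline 0.
have d0 : T d <> 0 by move=> d0; apply: nd; rewrite d0; exact: line_refl.
have [sg sgd] : {sg : F1 -> F2 & forall a, T (a *: d) = sg a *: T d}.
  by apply: (choice (fun a => TZ a d)).
(* Expanding [T (a *: (d + e))] in two ways, the coefficients of [T d] and [T e] show that [e] has
   the same factor as [d]. *)
have sg_nonline a e : ~ line (T d) (T e) -> T (a *: e) = sg a *: T e.
  move=> nde; have [k Te] := TZ a e; have [m Tde] := TZ a (d + e).
  move: Tde; rewrite scalerDr !parallel_additive scalerDr sgd Te => Tde.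
  have km := nonline_coef nde Tde; congr (_ *: _); rewrite km in Tde *.
  by have /scale_sfield_inj -> := addIr _ Tde.
have sgE a e : T (a *: e) = sg a *: T e.
  have [lde|] := pselect (line (T d) (T e)); last exact: sg_nonline.
  (* Both [e'] and [e + e'] have images off the line of [T d], so the previous case applies to them;
     subtract. *)
  have [e' nde'] := T_nonline (T d).
  apply: (addIr (T (a *: e'))); rewrite -parallel_additive -scalerDr.
  rewrite !sg_nonline // ?parallel_additive ?scalerDr //.
  move=> lee'; apply: nde'; rewrite -(addKr (T e) (T e')) addrC.
  exact: lineB.
have sgD : zmod_morphism sg.
  move=> a b; apply: (scale_sfield_inj d0); apply: (addIr (sg b *: T d)).
  by rewrite -sgE -sgE -parallel_additive -scalerDl subrK scalerBl -sgE -sgE subrK.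
have sgM : monoid_morphism sg.
  split; first by apply: (scale_sfield_inj d0); rewrite -sgE !scale1r.
  by move=> a b; apply: (scale_sfield_inj d0); rewrite -sgE -!scalerA !sgE.
pose sgR : {rmorphism F1 -> F2} := HB.pack sg
  (GRing.isZmodMorphism.Build _ _ sg sgD) (GRing.isMonoidMorphism.Build _ _ sg sgM).
by exists sgR.
Qed.
End Semilinear.

(** * Orthogonal closure of lines and planes *)

Section HermitianVectors.
Variables (F : starSfieldType) (H : hermitianType F).
Implicit Types (x y z u v w : H).

Lemma hermDl u v w : herm (u + v) w = herm u w + herm v w.
Proof. by have := hermDZl 1 1 u v w; rewrite !scale1r !mul1r. Qed.

Lemma hermDr u v w : herm w (u + v) = herm w u + herm w v.
Proof. by rewrite herm_star hermDl starD -!herm_star. Qed.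

Lemma hermBl u v w : herm (u - v) w = herm u w - herm v w.
Proof. by rewrite hermDl -scaleN1r hermZl mulN1r. Qed.

(* As [0^-1 = 0], [reject 0 y] is [y]. *)
Definition reject x y := y - (herm y x * (herm x x)^-1) *: x.

Lemma herm_reject x y : herm (reject x y) x = 0.
Proof.
rewrite hermBl hermZl; have [/herm_anisotropic x0|xx] := eqVneq (herm x x) 0.
  by rewrite !(herm_sym0 (_ : herm x y = 0)) x0 ?herm0l // !mul0r subrr.
by rewrite -mulrA mulVr ?sfield_unit // mulr1 subrr.
Qed.

Lemma span2_reject x y : span2 x y (reject x y).
Proof.
by exists (- (herm y x * (herm x x)^-1)), 1; rewrite scaleNr scale1r addrC.
Qed.

Lemma reject_span2 x y : span2 x (reject x y) y.
Proof.
by exists (herm y x * (herm x x)^-1), 1; rewrite scale1r /reject addrC subrK.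
Qed.

Lemma herm_span2_eq0 x y z w : span2 x y z ->
  herm x w = 0 -> herm y w = 0 -> herm z w = 0.
Proof. by move=> [a [b ->]] xw yw; rewrite hermDZl xw yw !mulr0 addr0. Qed.

(** Gram-Schmidt: the remainder [z'] of [z] is orthogonal to [x] and [y], hence by hypothesis to
    [z], hence to itself; anisotropy makes it zero. *)
Lemma span2_closed x y z :
  (forall w, herm x w = 0 -> herm y w = 0 -> herm z w = 0) -> span2 x y z.
Proof.
move=> xyz; set y' := reject x y; set z' := reject y' (reject x z).
have z'y' : herm z' y' = 0 by exact: herm_reject.
have z'x : herm z' x = 0.
  by rewrite (herm_span2_eq0 (span2_reject _ _)) // herm_reject.
have xz' := herm_sym0 z'x; have y'z' := herm_sym0 z'y'.
have yz' : herm y z' = 0 by exact: herm_span2_eq0 (reject_span2 x y) _ _.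
have z'z' : herm z' z' = 0.
  rewrite {1}/z' (herm_span2_eq0 (span2_reject _ _)) //.
  by rewrite (herm_span2_eq0 (span2_reject _ _)) ?xyz.
have := reject_span2 y' (reject x z); rewrite -/z' (herm_anisotropic _ z'z').
move=> /(span2_trans _ _ (x := x) (y := y)) z1.
apply: span2_trans (reject_span2 x z); first exact: span2l.
apply: z1; first exact: span2_reject.
by exists 0, 0; rewrite !scale0r addr0.
Qed.

Lemma line_closed x z :
  (forall w, herm x w = 0 -> herm z w = 0) -> line x z.
Proof.
move=> xz; have [|a [b ->]] := @span2_closed x x z; first by move=> w /xz.
by exists (a + b); rewrite scalerDl.
Qed.

Lemma nonline_separated x y : ~ line x y ->
  exists2 w, herm x w = 0 & herm y w != 0.
Proof.
move=> nxy; apply: contrapT => nw; apply/nxy/line_closed => w xw.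
by apply/eqP/negP => /negP yw; apply: nw; exists w.
Qed.

End HermitianVectors.

(** * Vector maps representing an adjoint pair *)

Section AdjointPair.
Variables (F1 F2 : starSfieldType) (H1 : hermitianType F1) (H2 : hermitianType F2).
(** These stand for arbitrary choices of spanning vectors, so no linearity is assumed of them. *)
Variables (h : H1 -> H2) (k : H2 -> H1).
Hypothesis h_adj : forall u v, herm (h u) v = 0 <-> herm u (k v) = 0.

Lemma adjoint_span2 u v z : span2 u v z -> span2 (h u) (h v) (h z).
Proof.
move=> uvz; apply: span2_closed => w /h_adj uw /h_adj vw; apply/h_adj.
exact: herm_span2_eq0 uvz _ _.
Qed.

Lemma adjoint_line u v : line u v -> line (h u) (h v).
Proof.
move=> [a ->]; apply: line_closed => w /h_adj uw; apply/h_adj.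
by rewrite hermZl uw mulr0.
Qed.

Lemma adjoint_proportional u v : proportional u v -> proportional (h u) (h v).
Proof.
move=> uv; apply: mutual_proportional; apply: adjoint_line.
  exact/proportional_line/proportional_sym.
exact: proportional_line.
Qed.

(** * Normalized representatives on an affine hyperplane *)

Section Normalization.
Variables (v : H2) (w : H1).
Hypothesis w_def : w = k v.

Definition normalized p := (herm (h p) v)^-1 *: h p.

Lemma herm_image_neq0 p : herm p w = 1 -> herm (h p) v != 0.
Proof.
move=> pw; apply/eqP => /h_adj; rewrite -w_def pw => /eqP.
by rewrite oner_eq0.
Qed.

Lemma normalized_proportional p :
  herm p w = 1 -> proportional (normalized p) (h p).
Proof.
move=> /herm_image_neq0 pv; exists (herm (h p) v)^-1 => //.
apply: contra_neq pv => pv; by rewrite -[LHS]invrK pv invr0.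
Qed.

Lemma herm_normalized p : herm p w = 1 -> herm (normalized p) v = 1.
Proof.
by move=> /herm_image_neq0 pv; rewrite hermZl mulVr ?sfield_unit.
Qed.

(* Both images have [v]-component 1, so their difference is the point at
   infinity of the line joining them. *)
Lemma normalized_sub p q : herm p w = 1 -> herm q w = 1 ->
  proportional (normalized p - normalized q) (h (p - q)).
Proof.
move=> pw qw; have dv : herm (h (p - q)) v = 0.
  by apply/h_adj; rewrite -w_def hermBl pw qw subrr.
have [] : span2 (normalized q) (h (p - q)) (normalized p).
  have := proportional_line (normalized_proportional pw).
  apply: line_span2; apply: span2_trans (adjoint_span2 (_ : span2 q (p - q) p)).
  - apply: line_span2 (span2l _ _) _; apply: proportional_line.
    exact/proportional_sym/normalized_proportional.
  - exact: span2r.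
  - by exists 1, 1; rewrite !scale1r addrC subrK.
move=> a [b pab]; have a1 : a = 1.
  have := herm_normalized pw.
  by rewrite pab hermDZl (herm_normalized qw) dv mulr0 addr0 mulr1.
rewrite a1 scale1r in pab; rewrite pab [_ + b *: _]addrC addrK.
(* A factor 0 is not allowed by [proportional]. If [b = 0], then [h (p - q)] lies on the line of
   [h q] and is orthogonal to [v], while [h q] is not; so it vanishes. *)
have [b0|b0] := eqVneq b 0; last by exists b.
suff -> : h (p - q) = 0 by exists 1; rewrite ?oner_neq0 // !scaler0.
have : span2 (h p) (h q) (h (p - q)).
  by apply: adjoint_span2; exists 1, (-1); rewrite scaleN1r scale1r.
have hpq : line (h q) (h p).
  have /proportional_line := proportional_sym (normalized_proportional pw).
  rewrite pab b0 scale0r addr0 => /(line_trans _); apply.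
  exact/proportional_line/normalized_proportional.
move=> [c [d]] hc; have [e he] : line (h q) (h (p - q)).
  rewrite hc; apply: lineD; last exact/lineZ/line_refl.
  exact: lineZ.
move: dv; rewrite he hermZl => ev; suff -> : e = 0 by rewrite scale0r.
by rewrite -(mulrK (sfield_unit (herm_image_neq0 qw)) e) ev mul0r.
Qed.

End Normalization.

(** By adjointness, [sigma] maps the ratio of the products of [u2] and [u1] with [k v] to the ratio
    of those of [h u2] and [h u1] with [v]. Independence of the two images lets [v] prescribe the
    latter ratio. *)
Lemma adjoint_semilinear_bijective (sigma : {rmorphism F1 -> F2}) u1 u2 :
  {morph h : u v / u + v} -> (forall a u, h (a *: u) = sigma a *: h u) ->
  ~ line (h u1) (h u2) -> ~ line (h u2) (h u1) -> bijective sigma.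
Proof.
move=> hD hZ n12 n21.
have [v1 u2v1 c1] := nonline_separated n21.
have [v2 u1v2 c2] := nonline_separated n12.
have sigma_surj g : exists r, sigma r = g.
  have [->|g0] := eqVneq g 0; first by exists 0; rewrite rmorph0.
  have Ug := sfield_unit g0; have U1 := sfield_unit c1; have U2 := sfield_unit c2.
  (* The factor in front of [v1] is chosen to make [herm (h u1) v = g^-1 * c2]. *)
  pose v := star ((herm (h u1) v1)^-1 * (g^-1 * herm (h u2) v2)) *: v1 + v2.
  have hDr x : herm x v =
      herm x v1 * ((herm (h u1) v1)^-1 * (g^-1 * herm (h u2) v2)) + herm x v2.
    by rewrite hermDr hermZr starK.
  have h1v : herm (h u1) v = g^-1 * herm (h u2) v2.
    by rewrite hDr u1v2 addr0 mulVKr.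
  have h2v : herm (h u2) v = herm (h u2) v2 by rewrite hDr u2v1 mul0r add0r.
  have p0 : herm u1 (k v) != 0.
    apply/eqP => /h_adj; rewrite h1v => gc0; move: c2.
    by rewrite -(mulVKr Ug (herm _ _)) gc0 mulr0 eqxx.
  exists (herm u2 (k v) * (herm u1 (k v))^-1).
  have : herm (- (herm u2 (k v) * (herm u1 (k v))^-1) *: u1 + u2) (k v) = 0.
    by rewrite hermDl hermZl mulNr -mulrA mulVr ?sfield_unit // mulr1 addNr.
  move=> /h_adj; rewrite hD hZ hermDl hermZl h1v h2v rmorphN mulNr.
  move=> /eqP; rewrite addrC subr_eq0 mulrA -[eqbLHS]mul1r => /eqP/(mulIr U2) gE.
  by rewrite -(mulrK Ug (sigma _)) -[RHS]mul1r gE mulrVK // mulrK.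
have [tau tauK] := choice sigma_surj.
have sigma_inj : injective sigma.
  move=> a b ab; apply/eqP; rewrite -subr_eq0; apply/negP => /negP/sfield_unit Uab.
  move: (oner_neq0 F2); rewrite -(rmorph1 sigma) -(mulVr Uab) rmorphM.
  by rewrite rmorphB ab subrr mulr0 eqxx.
by exists tau => // a; apply: sigma_inj; rewrite tauK.
Qed.

(** * Construction of the semilinear map *)

Hypothesis h_nonplanar : forall x y, exists u, ~ span2 x y (h u).

Lemma adjoint_semilinear : exists (phi : H1 -> H2) (sigma : {rmorphism F1 -> F2}),
  [/\ {morph phi : u v / u + v}, forall a u, phi (a *: u) = sigma a *: phi u &
      forall u, proportional (phi u) (h u)].
Proof.
(* As [span2 0 0] is zero, [h u0] is not. Taking [v] to be [h u0] itself, anisotropy keeps [u0] off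
   the hyperplane orthogonal to [w]. *)
have [u0 nu0] := h_nonplanar 0 0; set v := h u0.
pose w := k v; have wE : w = k v by [].
have u0w : herm u0 w != 0.
  apply/eqP => /h_adj /herm_anisotropic hu0; apply: nu0.
  by rewrite -/v [v]hu0; exact: span2l.
pose a := (herm u0 w)^-1 *: u0.
have aw : herm a w = 1 by rewrite hermZl mulVr ?sfield_unit.
pose n := normalized v; pose P d := d - herm d w *: a.
have Pw d : herm (P d) w = 0 by rewrite hermBl hermZl aw mulr1 subrr.
have aPw d : herm (a + P d) w = 1 by rewrite hermDl aw Pw addr0.
have PD : {morph P : d e / d + e}.
  by move=> d e; rewrite /P hermDl scalerDl opprD addrACA.
have PZ s d : P (s *: d) = s *: P d.
  by rewrite /P hermZl -scalerA scalerBr.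
pose T d := n (a + P d) - n a.
have Th d : proportional (T d) (h (P d)).
  have := normalized_sub wE (aPw d) aw.
  by rewrite [a + P d - a]addrC addKr.
(* Moving the base point from [a] to [a + P d] changes the difference only by a factor: both
   differences span the line of [h (P e)]. *)
have TD d e : exists c, T (d + e) = T d + c *: T e.
  have [c _ nc] : proportional (n (a + P (d + e)) - n (a + P d)) (T e).
    apply: proportional_trans (proportional_sym (Th e)).
    have := normalized_sub wE (aPw (d + e)) (aPw d).
    by rewrite PD addrA [a + P d + P e - _]addrC addKr.
  by exists c; rewrite -nc /T [RHS]addrC [RHS]addrA subrK.
have TZ s d : line (T d) (T (s *: d)).
  apply: line_trans (proportional_line (Th _)); rewrite PZ.
  apply: line_trans (proportional_line (proportional_sym (Th d))) _.
  by apply: adjoint_line; exists s.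
(* Since [e] is in the span of [a] and [P e], having [T e] on the line of [y] would put [h e] in the
   plane of [h a] and [y]. *)
have T_nonline y : exists e, ~ line y (T e).
  have [e ne] := h_nonplanar (h a) y; exists e => ye; apply: ne.
  apply: span2_trans (adjoint_span2 (_ : span2 a (P e) e)).
  - exact: span2l.
  - apply: line_span2 (span2r _ _) _; apply: line_trans ye _.
    exact/proportional_line/proportional_sym.
  - by exists (herm e w), 1; rewrite scale1r addrC subrK.
have [sigma sigmaE] := parallel_semilinear TD TZ T_nonline.
have Tadd := parallel_additive TD T_nonline.
exists (fun u => sigma (herm u w) *: n a + T u), sigma; split.
- by move=> u u' /=; rewrite hermDl rmorphD scalerDl Tadd addrACA.
- by move=> s u /=; rewrite hermZl rmorphM sigmaE [RHS]scalerDr scalerA.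
move=> u; have [uw|uw] := eqVneq (herm u w) 0.
  rewrite uw rmorph0 scale0r add0r; have := Th u.
  by rewrite /P uw scale0r subr0.
(* Scaling [u] into the affine hyperplane gives [d = a + P d], so [n a + T d] is [n d] and the value
   at [u] is [sigma s *: n d]. *)
set s := herm u w in uw *; pose d := s^-1 *: u.
have ud : u = s *: d by rewrite /d scalerA mulrV ?sfield_unit // scale1r.
have dw : herm d w = 1 by rewrite hermZl mulVr ?sfield_unit.
have daP : d = a + P d by rewrite /P dw scale1r addrC subrK.
apply: (proportional_trans (y := h d)).
  apply: proportional_trans (normalized_proportional wE dw).
  exists (sigma s); last first.
    by rewrite {1}ud sigmaE -scalerDr /T -daP -/n addrC subrK.
  apply/eqP => s0; move: (oner_neq0 F2); rewrite -(rmorph1 sigma).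
  by rewrite -(mulVr (sfield_unit uw)) rmorphM s0 mulr0 eqxx.
by apply/adjoint_proportional/proportional_sym; rewrite {1}ud; exists s.
Qed.

End AdjointPair.

(** * Rank and orthogonal triples *)

Lemma card_ge_II_inj T (B : set T) n : `I_n #<= B ->
  exists e : 'I_n -> T, (forall i, B (e i)) /\ injective e.
Proof.
move=> /card_leP[f].
have n_i (i : 'I_n) : (i : nat) \in `I_n by rewrite inE /=; exact: ltn_ord.
exists (fun i => val (f (SigSub (n_i i)))); split=> [i|i j /val_inj fij].
  exact: set_valP.
have := 'inj_f _ _ fij; rewrite !inE => /(_ I I) /(congr1 val) /= ij.
exact: val_inj.
Qed.

(** Infinite rank only denies a maximum, so the size is raised one by one: if [m < n] could not be
    exceeded, the rank would be [m]. *)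
Lemma rank_orthogonal_set (X : orthosetType) n : (n%:Z%:E <= rank X)%E ->
  exists A : set X, orthogonal_set A /\ A #= `I_n.
Proof.
move=> n_rank; suff : forall m, (m <= n)%N ->
    exists A : set X, orthogonal_set A /\ A #= `I_m by apply.
elim=> [_|m IHm m_n].
  by exists set0; split=> //; rewrite II0 card_eq00.
apply: contrapT => noA; have maxm : max_orthogonal X m.
  split=> [|B oB]; first exact/IHm/ltnW.
  apply: contrapT => Bm; have mB : `I_m.+1 #<= B.
    have [/finite_setP[k Bk]|/infiniteP] := pselect (finite_set B).
      rewrite (card_le_eqr Bk) card_le_II ltnNge; apply/negP => km.
      by apply: Bm; rewrite (card_le_eql Bk) card_le_II.
    by apply: card_le_trans; exact: card_leT.
  have [e [Be e_inj]] := card_ge_II_inj mB.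
  apply: noA; exists (range e); split.
    have [B0 Bo] := oB; split=> [x [i _ <-]|x y [i _ <-] [j _ <-]]; first exact: B0.
    exact: Bo.
  rewrite (card_eql (inj_card_eq (in2W e_inj))) card_eq_sym; exact: card_II.
by move: n_rank; rewrite (rankE maxm) lee_fin lez_nat leqNgt m_n.
Qed.

(** A plane containing the image contains its biorthogonal closure, hence three orthogonal nonzero
    vectors. Two of them already span the plane, so the third is orthogonal to itself. *)
Lemma map_rank_nonplanar (F1 F2 : starSfieldType)
    (H1 : hermitianType F1) (H2 : hermitianType F2)
    (f : projective H1 -> projective H2) (h : H1 -> H2) :
  (forall u, f (pline u) = pline (h u)) -> (3%:E <= map_rank f)%E ->
  forall x y, exists u, ~ span2 x y (h u).
Proof.
move=> hE /(@rank_orthogonal_set _ 3)[A [[A0 Ao] /card_eqPle[_]]] A3 x y.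
have [e [Ae e_inj]] := card_ge_II_inj A3.
apply: contrapT => hxy; have {}hxy u : span2 x y (h u).
  by apply: contrapT => nu; apply: hxy; exists u.
have /choice[p pE] (i : 'I_3) := plineP (sval (e i)).
have p0 i : p i <> 0.
  by move=> pi0; apply: (A0 (e i)) => //; apply: eq_sig_hprop => //=; rewrite pE pi0.
have po i j : i != j -> herm (p i) (p j) = 0.
  move=> ij; apply/pline_orthoE; rewrite -!pE; apply: Ao => //.
  by move=> /e_inj/eqP; rewrite (negbTE ij).
have pxy i : span2 x y (p i).
  apply: span2_closed => w xw yw; apply/pline_orthoE; rewrite -pE.
  apply: (svalP (e i)) => _ [L _ <-]; have [u ->] := plineP L.
  by rewrite hE; apply/pline_orthoE/herm_sym0; exact: herm_span2_eq0 (hxy u) _ _.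
pose i1 : 'I_3 := lift ord0 ord0.
have np : ~ line (p ord0) (p i1).
  move=> [a p1E]; apply: (p0 i1); apply: herm_anisotropic.
  by rewrite {1}p1E hermZl po ?mulr0.
have := span2_nonline_sub (p0 ord0) (pxy _) (pxy _) np (pxy ord_max).
by move=> /herm_span2_eq0 p2; apply/(p0 ord_max)/herm_anisotropic/p2; exact: po.
Qed.

Theorem theorem3p21 (F1 F2 : starSfieldType)
    (H1 : hermitianType F1) (H2 : hermitianType F2)
    (f : projective H1 -> projective H2)
    (f_adj : adjointable f) (f_rank : (3%:E <= map_rank f)%E) :
  exists phi : H1 -> H2,
    quasilinear phi /\ forall u : H1, f (pline u) = pline (phi u).
Proof.
have [g fg] := f_adj.
have /choice[h hE] u := plineP (f (pline u)).
have /choice[k kE] v := plineP (g (pline v)).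
(* Kept general in [h'] because it serves first for the chosen representatives [h], then for
   [phi]. *)
have adj h' : (forall u, f (pline u) = pline (h' u)) ->
    forall u v, herm (h' u) v = 0 <-> herm u (k v) = 0.
  by move=> h'E u v; rewrite -!pline_orthoE -h'E -kE; exact: fg.
have [phi [sigma [phiD phiZ phi_h]]] :=
  adjoint_semilinear (adj h hE) (map_rank_nonplanar hE f_rank).
have phiE u : f (pline u) = pline (phi u).
  by rewrite hE; apply/proportional_pline/proportional_sym.
have nonplanar := map_rank_nonplanar phiE f_rank.
exists phi; split=> //; exists sigma; split=> //.
(* With a zero generator the plane degenerates: [phi u1] is nonzero and [phi u2] is off its line. *)
have [u1 nu1] := nonplanar 0 0; have [u2 nu2] := nonplanar (phi u1) 0.
have n12 : ~ line (phi u1) (phi u2).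
  by move=> /(line_span2 (span2l _ _)) /nu2.
apply: (adjoint_semilinear_bijective (adj phi phiE) phiD phiZ n12).
move=> [a u1E]; apply: n12; apply: (@lineK _ _ a).
  by apply/eqP => a0; apply: nu1; rewrite u1E a0 scale0r; exact: span2l.
by rewrite -u1E; exact: line_refl.
Qed.
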